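(* Let $\{\omega_x\}_{x\in\mathbb Z^2}$ be independent rate $1$ exponentially distributed random variables. Then for every $h=(h_1,h_2)\in\mathbb R^2$, with probability $1$, $$\lim_{n\to\infty}n^{-1}G_n(h)=g_{\rm pl}(h)\equiv1+\frac{h_1+h_2}{2}+\frac12\sqrt{(h_1-h_2)^2+4}\,.$$
   Context: The point-to-line last-passage value is $G_n(h)=\max_{x_{0,n}:\,x_0=0}\bigl\{\sum_{k=0}^{n-1}\omega_{x_k}+h\cdot x_n\bigr\}$, the maximum being over $n$-step lattice paths $(x_k)_{k=0}^n$ in $\mathbb Z^2$ started at $x_0=0$ with increments in $\{e_1,e_2\}=\{(1,0),(0,1)\}$. *)

(* Defs.v *)
From mathcomp Require Import all_boot all_order all_algebra.
From mathcomp Require Import finmap.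
From mathcomp Require Import all_classical all_reals all_analysis.

Set Implicit Arguments.
Unset Strict Implicit.
Unset Printing Implicit Defensive.

Import Order.TTheory GRing.Theory Num.Theory.
Import numFieldNormedType.Exports.

Local Open Scope classical_set_scope.
Local Open Scope ring_scope.

Section probability_notions.
Context d (T : measurableType d) (R : realType) (P : probability T R).

Definition mutually_independent (I : choiceType) d' (T' : measurableType d')
    (X : I -> {RV P >-> T'}) : Prop :=
  forall (J : {fset I}) (A : I -> set T'), (forall i, measurable (A i)) ->
    P (\bigcap_(i in [set` J]) (X i @^-1` A i)) =
    (\prod_(i <- J) P (X i @^-1` A i))%E.

(* The two laws are compared on measurable sets only: both sides are functions
   on all subsets of R, with irrelevant values outside the Borel sets. *)
Definition exponentially_distributed (rate : R) (X : {RV P >-> R}) : Prop :=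
  forall A : set R, measurable A -> distribution P X A = exponential_prob rate A.

End probability_notions.

Notation site := (int * int)%type.

Section last_passage_percolation.
Context {R : realType}.

Definition e1 : site := (1, 0).
Definition e2 : site := (0, 1).

Definition dot (h : R * R) (x : site) : R :=
  h.1 * x.1%:~R + h.2 * x.2%:~R.

(* An n-step path is the restriction of x to {0, ..., n}; the values of x
   beyond n are unconstrained and do not enter path_weight. *)
Definition lattice_path (n : nat) (x : nat -> site) : Prop :=
  x 0%N = 0 /\
  forall k, (k < n)%N -> x k.+1 - x k = e1 \/ x k.+1 - x k = e2.

Definition path_weight (w : site -> R) (h : R * R) (n : nat)
    (x : nat -> site) : R :=
  \sum_(k < n) w (x k) + dot h (x n).

(* This supremum is a maximum, see point_to_line_attained below. *)
Definition point_to_line (w : site -> R) (n : nat) (h : R * R) : R :=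
  sup [set path_weight w h n x | x in lattice_path n].

Definition g_pl (h : R * R) : R :=
  1 + (h.1 + h.2) / 2 + 1 / 2 * Num.sqrt ((h.1 - h.2) ^+ 2 + 4).

Lemma point_to_line_attained (w : site -> R) (n : nat) (h : R * R) :
  (exists2 x, lattice_path n x & point_to_line w n h = path_weight w h n x) /\
  (forall x, lattice_path n x -> path_weight w h n x <= point_to_line w n h).
Proof.
pose walk (s : {ffun 'I_n -> bool}) (k : nat) : site :=
  \sum_(i < n | (i < k)%N) (if s i then e1 else e2).
have walkS s (k : nat) (kn : (k < n)%N) :
    walk s k.+1 - walk s k = if s (Ordinal kn) then e1 else e2.
  rewrite /walk (bigD1 (Ordinal kn)) //= -addrA.
  rewrite (eq_bigl (fun i : 'I_n => (i < k)%N)) ?subrr ?addr0// => i.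
  rewrite -val_eqE /= ltnS ltn_neqAle andbC; reflexivity.
have walkP s : lattice_path n (walk s).
  split=> [|k kn]; first by rewrite /walk big_pred0.
  by rewrite (walkS s k kn); case: (s _); [left|right].
have walkE x : lattice_path n x ->
    exists s, path_weight w h n x = path_weight w h n (walk s).
  move=> [x0 xS]; exists [ffun i : 'I_n => x i.+1 - x i == e1].
  set s := [ffun i => _].
  have xE k : (k <= n)%N -> x k = walk s k.
    elim: k => [_|k IH kn]; first by rewrite x0 /walk big_pred0.
    rewrite -[LHS](subrK (x k)) -[RHS](subrK (walk s k)) -IH 1?ltnW//.
    congr (_ + _); rewrite IH 1?ltnW// walkS -IH 1?ltnW// ffunE /=.
    by case: eqP => // ne1; case: (xS k kn).
  rewrite /path_weight xE//; congr (_ + _).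
  by apply: eq_bigr => i _; rewrite xE// ltnW.
pose F s := path_weight w h n (walk s).
pose s0 : {ffun 'I_n -> bool} := [ffun=> true].
case: (Order.TotalTheory.arg_maxP (P := predT) F (erefl : predT s0)) => m _ mmax.
have ubm : ubound [set path_weight w h n x | x in lattice_path n] (F m).
  by move=> _ [x /walkE [s ->] <-]; exact: mmax.
have inm : [set path_weight w h n x | x in lattice_path n] (F m).
  by exists (walk m).
have GE : point_to_line w n h = F m.
  apply/eqP; rewrite eq_le; apply/andP; split.
    by apply: ge_sup => //; exists (F m).
  by apply: ub_le_sup => //; exists (F m).
by split=> [|x xn]; [exists (walk m) | rewrite GE; apply: ubm; exists x].
Qed.

End last_passage_percolation.

(* Main.v *)
Require Import Defs.
From mathcomp Require Import all_boot all_order all_algebra.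
From mathcomp Require Import finmap.
From mathcomp Require Import all_classical all_reals all_analysis.
From mathcomp Require Import measurable_realfun ring lra.

(* Let t = g_pl h.  Then a = 1/(t - h1) and b = 1/(t - h2) are positive with
   a + b = 1, so there is a stationary version of the model with exponential
   increments of rates a along e1 and b along e2.  Giving the line i + j = n the
   terminal values F(i, j) = t n - SI(i) - SJ(j), where SI and SJ are partial sums
   of independent Exp(a) and Exp(b) variables, Burke's theorem makes the increments
   of the last-passage value along the first axis independent Exp(a) variables.
   Hence the value at 0 is t n - SI(n) + (sum of n independent Exp(a)), which is
   t n + o(n) by a Chernoff bound and Borel-Cantelli.  By the law of large
   numbers for SI and SJ, F is uniformly within o(n) of h . (i, j), and the
   last-passage value is 1-Lipschitz in F for the uniform norm.
   The boundary variables are the weights at sites with a negative coordinate,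
   rescaled, so that no extension of the probability space is needed. *)

Set Implicit Arguments.
Unset Strict Implicit.
Unset Printing Implicit Defensive.

Import Order.TTheory GRing.Theory Num.Theory.
Import numFieldNormedType.Exports.

Local Open Scope classical_set_scope.
Local Open Scope ring_scope.

(** * Exponential laws *)

Definition pushforward_law d d' (T : measurableType d)
    (T' : measurableType d') (R : realType) (p : probability T R) (f : T -> T')
    (mf : measurable_fun setT f) : probability T' R :=
  distribution p (mfun_Sub (mem_set mf)).

(* The library's measure lives on [measurableTypeR R], whose display differs from
   that of [R]; the identity transports it. *)
Definition exp_law (R : realType) (r : R) (r0 : 0 < r) : probability R R :=
  @pushforward_law _ _ (measurableTypeR R) R R
    (exponential_distribution_exponential_prob__canonical__probability_measure_Probability r0)
    idfun (@measurable_id _ _ setT).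

Lemma exp_lawE (R : realType) (r : R) (r0 : 0 < r) A :
  exp_law r0 A = exponential_prob r A.
Proof. by []. Qed.

Definition pushforward_measure d d' (T : measurableType d)
    (T' : measurableType d') (R : realType)
    (m : {measure set T -> \bar R}) (f : T -> T')
    (mf : measurable_fun setT f) : {measure set T' -> \bar R} :=
  measure_function_pushforward__canonical__measure_function_Measure m mf.

Definition restricted_measure d (T : measurableType d) (R : realType)
    (m : {measure set T -> \bar R}) (D : set T) (mD : measurable D) :
    {measure set T -> \bar R} := mrestr m mD.

Lemma exp_law_eq (R : realType) (r r' : R) (r0 : 0 < r) (r0' : 0 < r') :
  r = r' -> exp_law r0 = exp_law r0'.
Proof. by move=> rr'; subst r'; congr exp_law; exact: Prop_irrelevance. Qed.

(** * Measures determined by rectangles and by upper rays *)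

Section uniqueness.
Context {R : realType}.
Local Open Scope ereal_scope.

(** Rectangles determine a finite measure on a product. The factor [c] leaves room for laws
    restricted to an event, which have mass below one. *)
Lemma product_law_unique d1 d2 (T1 : measurableType d1) (T2 : measurableType d2)
    (mu : probability T1 R) (nu : probability T2 R) (c : {nonneg R})
    (m : {measure set (T1 * T2) -> \bar R}) :
  (forall A B, measurable A -> measurable B ->
    m (A `*` B) = c%:num%:E * (mu A * nu B)) ->
  forall S, measurable S -> m S = c%:num%:E * (mu \x nu) S.
Proof.
move=> mE S mS.
have <- : (mscale c mu \x nu) S = m S.
  apply: product_measure_unique => // A B mA mB.
  by rewrite mE// muleA.
rewrite /product_measure1 ge0_integral_mscale//.
exact: measurable_fun_xsection.
Qed.

Lemma exp_law_gt (r : R) (r0 : (0 < r)%R) (x : R) : (0 <= x)%R ->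
  exp_law r0 `]x, +oo[%classic = (expR (- (r * x)))%:E.
Proof.
move=> x0.
have mray (i : interval R) : measurable ([set` i] : set R).
  exact: measurable_itv.
have E0c : exp_law r0 `[0%R, x]%classic = 1 - (expR (- (r * x)))%:E.
  rewrite exp_lawE; move: x0; rewrite le_eqVlt => /predU1P[<-|x0].
    by rewrite set_itv1 /exponential_prob integral_set1 mulr0 oppr0 expR0 subee.
  by rewrite exponential_prob_itv0c// mulNr.
have EN0 : exp_law r0 `]-oo, 0%R[%classic = 0.
  rewrite exp_lawE /exponential_prob integral0_eq// => y /=.
  by rewrite in_itv /= => y0; rewrite lt0_exponential_pdf.
have Ec : exp_law r0 `]-oo, x]%classic = 1 - (expR (- (r * x)))%:E.
  rewrite (_ : `]-oo, x]%classic = `]-oo, 0%R[%classic `|` `[0%R, x]%classic); last first.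
    apply/seteqP; split => y /=; rewrite !in_itv /=.
      by have [y0 _|y0 ->] := ltP y 0%R; [left|right].
    by case=> [/ltW/le_trans|/andP[]]//; exact.
  rewrite measureU//; last first.
    by apply/seteqP; split => // y /=; rewrite !in_itv /= => -[]; case: ltP.
  exact: etrans (congr2 _ EN0 E0c) (add0e _).
rewrite -setCitvl probability_setC//.
by transitivity (1 - (1 - (expR (- (r * x)))%:E)); [congr (_ - _)|rewrite -!EFinB subKr].
Qed.

(** The rays []x, +oo[] are stable under intersection and generate the Borel sets, so tails
    determine the measure. *)
Lemma exp_law_unique (r : R) (r0 : (0 < r)%R) (c : {nonneg R})
    (m : {measure set R -> \bar R}) :
  (forall x : R, (0 <= x)%R -> m `]x, +oo[%classic = (c%:num * expR (- (r * x)))%:E) ->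
  m setT = c%:num%:E ->
  forall A, measurable A -> m A = c%:num%:E * exp_law r0 A.
Proof.
move=> mE mT A mA.
rewrite -[RHS]/(mscale c (exp_law r0) A).
have mray (x : R) : measurable (`]x, +oo[%classic : set R) by exact: measurable_itv.
pose g (k : nat) : set R := `](- k%:R)%R, +oo[%classic.
apply: (@measure_unique _ R R (@RGenOInfty.G R) g _ _ _ _ m (mscale c (exp_law r0))) => //.
- exact: RGenOInfty.measurableE.
- move=> _ _ [x ->] [y ->]; exists (Num.max x y).
  by apply/seteqP; split => z /=; rewrite !in_itv /= !andbT gt_max => /andP.
- by move=> k; exists (- k%:R)%R.
- apply/seteqP; split => // x _; exists (Num.bound `|x|) => //=.
  rewrite /g /= in_itv /= andbT ltrNl (le_lt_trans (ler_norm _))// normrN.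
  by rewrite (lt_le_trans (archi_boundP _)).
- move=> _ [x ->].
  have [x0|x0] := leP 0%R x.
    by rewrite mE//= /mscale /= exp_law_gt// EFinM.
  (* A ray from a negative [x] lies between []0, +oo[] and the whole line, both of mass [c]. *)
  have sub : `]0%R, +oo[%classic `<=` `]x, +oo[%classic.
    by move=> y /=; rewrite !in_itv /= !andbT; exact: lt_trans.
  transitivity (c%:num%:E).
    apply/eqP; rewrite eq_le -{1}mT le_measure ?inE//=.
    rewrite -[X in X <= _]mule1 -[X in _ * X](_ : (expR (- (r * 0)))%:E = 1); last first.
      by rewrite mulr0 oppr0 expR0.
    by rewrite -EFinM -mE// le_measure ?inE.
  rewrite -[RHS]/(c%:num%:E * exp_law r0 `]x, +oo[%classic) -[LHS]mule1.
  congr (_ * _).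
  apply/eqP; rewrite eq_le probability_le1// andbT.
  rewrite (_ : 1 = (expR (- (r * 0)))%:E); last by rewrite mulr0 oppr0 expR0.
  by rewrite -(exp_law_gt r0)// le_measure ?inE.
- move=> k; apply: (@le_lt_trans _ _ (m setT)); last by rewrite mT ltry.
  by apply: le_measure => //; rewrite inE; [exact: mray|exact: measurableT].
Qed.

End uniqueness.

Lemma exp_law_scale (R : realType) (r : R) (r0 : 0 < r) (A : set R) : measurable A ->
  exponential_prob 1 ((fun x => r^-1 * x) @^-1` A) = exp_law r0 A.
Proof.
move=> mA.
have mr : measurable_fun setT (fun x : R => r^-1 * x) by exact: measurable_funM.
pose m := pushforward_measure (exp_law (@ltr01 R)) mr.
have mray (x : R) : 0 <= x ->
    m `]x, +oo[%classic = ((1%:nng)%:num * expR (- (r * x)))%:E.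
  move=> x0; rewrite mul1r -[X in expR (- X)]mul1r -(exp_law_gt ltr01) ?mulr_ge0 ?(ltW r0)//.
  rewrite /m /= /pushforward; congr (exp_law _ _).
  by apply/seteqP; split => y /=; rewrite !in_itv /= !andbT ltr_pdivlMl.
have mT : m setT = ((1%:nng)%:num)%:E.
  by rewrite /m /= /pushforward preimage_setT probability_setT.
by rewrite -[RHS]mul1e -(exp_law_unique r0 mray mT mA).
Qed.

(** * Difference and minimum of two independent exponential variables *)

Section pair_laws.
Context {R : realType}.
Local Open Scope ereal_scope.

(** The restricted and shifted measure has tails [exp(-r w) exp(-r x)], so [exp_law_unique]
    identifies it. *)
Lemma exp_law_memoryless (r : R) (r0 : (0 < r)%R) (w : R) (A : set R) :
  (0 <= w)%R -> measurable A ->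
  exp_law r0 ((fun x => x - w)%R @^-1` A `&` `]w, +oo[%classic) =
  (expR (- (r * w)))%:E * exp_law r0 A.
Proof.
move=> w0 mA.
have mw : measurable (`]w, +oo[%classic : set R).
  exact: measurable_itv.
have mf : measurable_fun setT (fun x : R => (x - w)%R).
  exact: measurable_funB.
have e0 := expR_ge0 (- (r * w)).
pose m := pushforward_measure (restricted_measure (exp_law r0) mw) mf.
rewrite -[LHS]/(m A) -[(expR _)%:E]/((NngNum e0)%:num%:E).
apply: exp_law_unique => //= [x x0|].
  rewrite /m /= /pushforward /mrestr /=.
  rewrite (_ : _ `&` _ = `](w + x)%R, +oo[%classic); last first.
    apply/seteqP; split => y /=; rewrite !in_itv /= !andbT; first by case; lra.
    by move=> ?; split; lra.
  by rewrite exp_law_gt ?addr_ge0// -expRD; congr (expR _)%:E; lra.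
by rewrite /m /= /pushforward /mrestr /= preimage_setT setTI exp_law_gt.
Qed.


Definition diff_min (p : R * R) : R * R := (p.1 - p.2, Num.min p.1 p.2)%R.

(** From a difference [z] and a minimum [m] the pair is recovered as [m + z^+] and [m + z^-]. The
    increments of last-passage values at a site have this same form, with the weight in the place of
    [m]. *)
Definition undiff_min (p : R * R) : R * R :=
  (p.2 + Num.max p.1 0, p.2 + Num.max (- p.1) 0)%R.

Lemma diff_minK : cancel diff_min undiff_min.
Proof.
move=> [x y]; rewrite /undiff_min /diff_min /=.
by congr pair; rewrite /Num.min /Num.max; case: ifPn; case: ifPn; lra.
Qed.

Lemma measurable_diff_min : measurable_fun setT diff_min.
Proof.
apply: measurable_fun_pair; first exact: measurable_funB.
exact: measurable_minr.
Qed.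

Lemma measurable_undiff_min : measurable_fun setT undiff_min.
Proof.
apply: measurable_fun_pair; apply: measurable_funD => //.
  exact: measurable_maxr.
by apply: measurable_maxr => //; exact: measurableT_comp.
Qed.

Lemma measurable_diff : measurable_fun setT (fun p : R * R => p.1 - p.2)%R.
Proof. exact: measurable_funB. Qed.

Definition diff_law (a b : R) (a0 : (0 < a)%R) (b0 : (0 < b)%R) :
    probability R R :=
  pushforward_law (exp_law a0 \x exp_law b0) measurable_diff.

Lemma exp_pair_memoryless (a b : R) (a0 : (0 < a)%R) (b0 : (0 < b)%R)
    (w : R) (S : set (R * R)) : (0 <= w)%R -> measurable S ->
  (exp_law a0 \x exp_law b0)
    ((fun p => (p.1 - w, p.2 - w)%R) @^-1` S `&` (`]w, +oo[ `*` `]w, +oo[)) =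
  (expR (- ((a + b) * w)))%:E * (exp_law a0 \x exp_law b0) S.
Proof.
move=> w0 mS.
have mw : measurable (`]w, +oo[%classic : set R) by exact: measurable_itv.
have mf : measurable_fun setT (fun p : R * R => (p.1 - w, p.2 - w)%R).
  by apply: measurable_fun_pair; apply: measurable_funB.
have e0 := expR_ge0 (- ((a + b) * w)).
pose m := pushforward_measure
  (restricted_measure (exp_law a0 \x exp_law b0) (measurableX mw mw)) mf.
rewrite -[LHS]/(m S) -[(expR _)%:E]/((NngNum e0)%:num%:E).
apply: product_law_unique => // A B mA mB.
rewrite /m /= /pushforward /mrestr /=.
rewrite (_ : _ `&` _ = ((fun x => x - w)%R @^-1` A `&` `]w, +oo[%classic) `*`
   ((fun x => x - w)%R @^-1` B `&` `]w, +oo[%classic)); last first.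
  by apply/seteqP; split => -[x y] /= [[? ?] [? ?]].
have msub C : measurable C -> measurable ((fun x => x - w)%R @^-1` C `&` `]w, +oo[%classic).
  move=> mC; apply: measurableI => //.
  rewrite -[X in measurable X]setTI.
  have : measurable_fun setT (fun x : R => x - w)%R by exact: measurable_funB.
  exact.
rewrite product_measure1E; [|exact: msub|exact: msub].
transitivity ((expR (- (a * w)))%:E * exp_law a0 A *
              ((expR (- (b * w)))%:E * exp_law b0 B)).
  by congr (_ * _); exact: exp_law_memoryless.
rewrite muleACA -EFinM -expRD.
by congr ((expR _)%:E * _); lra.
Qed.

(** The event that the minimum exceeds [w] is a translation of both variables by [w], which leaves
    their difference unchanged. Memorylessness of the pair then gives, on any event for the
    difference, tails of the minimum proportional to [exp(-(a + b) w)]. *)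
Lemma diff_min_law (a b : R) (a0 : (0 < a)%R) (b0 : (0 < b)%R)
    (ab : (0 < a + b)%R) (A B : set R) : measurable A -> measurable B ->
  (exp_law a0 \x exp_law b0) (diff_min @^-1` (A `*` B)) =
  diff_law a0 b0 A * exp_law ab B.
Proof.
move=> mA mB.
have mdA : measurable ((fun p : R * R => p.1 - p.2)%R @^-1` A).
  by rewrite -[X in measurable X]setTI; exact: measurable_diff.
have mmin : measurable_fun setT (fun p : R * R => Num.min p.1 p.2).
  exact: measurable_minr.
pose m := pushforward_measure
  (restricted_measure (exp_law a0 \x exp_law b0) mdA) mmin.
have c0 : (0 <= fine (diff_law a0 b0 A))%R by rewrite fine_ge0.
have cE : (NngNum c0)%:num%:E = diff_law a0 b0 A.
  by rewrite -[LHS]/((fine (diff_law a0 b0 A))%:E) fineK// fin_num_measure.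
transitivity (m B).
  by congr (_ _); apply/seteqP; split => -[x y] /= [].
have mT : m setT = (NngNum c0)%:num%:E.
  by rewrite cE /m /= /pushforward /mrestr preimage_setT setTI.
have mray (w : R) : (0 <= w)%R ->
    m `]w, +oo[%classic = ((NngNum c0)%:num * expR (- ((a + b) * w)))%:E.
  move=> w0; rewrite EFinM cE muleC.
  have := exp_pair_memoryless a0 b0 w0 mdA => <-.
  congr (product_measure1 _ _ _).
  apply/seteqP; split => -[x y] /=; rewrite !in_itv /= !andbT lt_min.
    move=> [/andP[? ?] Axy]; split => //.
    by rewrite (_ : _ - _ - _ = x - y)%R//; ring.
  move=> [Axy [-> ->]]; split => //.
  by rewrite (_ : x - y = x - w - (y - w))%R//; ring.
by rewrite (exp_law_unique ab mray mT mB) cE.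
Qed.

(** By [diff_min_law] the left-hand product is the image of the original pair law under [diff_min],
    which [undiff_min] inverts. *)
Lemma undiff_min_law (a b : R) (a0 : (0 < a)%R) (b0 : (0 < b)%R)
    (ab : (0 < a + b)%R) (A B : set R) : measurable A -> measurable B ->
  (diff_law a0 b0 \x exp_law ab) (undiff_min @^-1` (A `*` B)) =
  exp_law a0 A * exp_law b0 B.
Proof.
move=> mA mB.
pose m : {measure set _ -> \bar R} :=
  pushforward_measure (exp_law a0 \x exp_law b0) measurable_diff_min.
have mAB : measurable (undiff_min @^-1` (A `*` B)).
  by rewrite -[X in measurable X]setTI; apply: measurable_undiff_min => //; exact: measurableX.
have mE C D : measurable C -> measurable D ->
    m (C `*` D) = (1%:nng)%:num%:E * (diff_law a0 b0 C * exp_law ab D).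
  by move=> mC mD; rewrite mul1e -diff_min_law.
have := product_law_unique mE mAB; rewrite mul1e => <-.
transitivity ((exp_law a0 \x exp_law b0) (A `*` B)).
  congr (product_measure1 _ _ _).
  rewrite -comp_preimage (_ : undiff_min \o diff_min = idfun)//.
  by apply/funext => p /=; rewrite diff_minK.
by rewrite product_measure1E.
Qed.

End pair_laws.

(** * Independent families and the Burke property *)

Definition pair_update (K : eqType) (R : Type) (b c : K) (phi : R * R -> R * R)
    (s : K -> R) (k : K) : R :=
  if k == b then (phi (s b, s c)).1
  else if k == c then (phi (s b, s c)).2 else s k.

Section independent_families.
Context d (T : measurableType d) (R : realType) (P : probability T R).
Context (K : choiceType).
Implicit Types (X : K -> T -> R) (mu : K -> probability R R).
Local Open Scope ereal_scope.

(** Independence and the marginal laws are kept in one product formula, so that a change of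
    variables can be tracked on both at once. *)
Definition indep_laws X mu : Prop :=
  (forall k, measurable_fun setT (X k)) /\
  forall (s : seq K) (A : K -> set R), uniq s -> (forall k, measurable (A k)) ->
    P (\bigcap_(k in [set` s]) X k @^-1` A k) = \prod_(k <- s) mu k (A k).

Lemma measurable_bigcap_seq X (s : seq K) (A : K -> set R) :
  (forall k, measurable_fun setT (X k)) -> (forall k, measurable (A k)) ->
  measurable (\bigcap_(k in [set` s]) X k @^-1` A k).
Proof.
move=> mX mA; rewrite bigcap_seq; apply: bigsetI_measurable => k _.
by rewrite -[X in measurable X]setTI; exact: mX.
Qed.

(** Restricted to an event [E] on the other coordinates, the pair at [b], [c] still has a product
    law, scaled by the probability of [E]. Uniqueness extends this from rectangles to the preimage
    under [phi]. *)
Lemma indep_laws_pair_update X mu mu' (b c : K) (phi : R * R -> R * R) :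
  b != c -> measurable_fun setT phi ->
  (forall k, k != b -> k != c -> mu' k = mu k) ->
  (forall A B, measurable A -> measurable B ->
    (mu b \x mu c) (phi @^-1` (A `*` B)) = mu' b A * mu' c B) ->
  indep_laws X mu ->
  indep_laws (fun k t => pair_update b c phi (X^~ t) k) mu'.
Proof.
move=> bc mphi mu'E muphi [mX XE].
have mXbc : measurable_fun setT (fun t => (X b t, X c t)).
  exact: measurable_fun_pair.
have mphiX : measurable_fun setT (fun t => phi (X b t, X c t)).
  exact: measurableT_comp mXbc.
split=> [k|s A us mA].
  rewrite /pair_update; case: (k == b); first exact: (measurableT_comp measurable_fst mphiX).
  by case: (k == c); [exact: (measurableT_comp measurable_snd mphiX)|exact: mX].
pose s' := [seq k <- s | (k != b) && (k != c)].
(* The sequence [s] may omit [b] or [c]; the full space, of probability one, then stands for the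
   missing constraint. *)
pose A0 k := if k \in s then A k else setT.
have mA0 k : measurable (A0 k) by rewrite /A0; case: ifP.
pose E := \bigcap_(k in [set` s']) X k @^-1` A k.
have mE : measurable E by exact: measurable_bigcap_seq.
pose p := \prod_(k <- s') mu k (A k).
have PE : P E = p by apply: XE => //; exact: filter_uniq.
have p0 : (0 <= fine p)%R by rewrite fine_ge0// -PE.
have pE : (NngNum p0)%:num%:E = p.
  by rewrite -[LHS]/((fine p)%:E) fineK// -PE fin_num_measure.
pose m := pushforward_measure (restricted_measure P mE) mXbc.
have mBC B C : measurable B -> measurable C ->
    m (B `*` C) = (NngNum p0)%:num%:E * (mu b B * mu c C).
  move=> mB mC; pose A1 k := if k == b then B else if k == c then C else A k.
  have mA1 k : measurable (A1 k) by rewrite /A1; do 2 case: ifP => // _.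
  have cb : c == b = false by rewrite eq_sym; exact/negbTE.
  transitivity (P (\bigcap_(k in [set` [:: b, c & s']]) X k @^-1` A1 k)).
    rewrite /m /= /pushforward /mrestr; congr (P _).
    apply/seteqP; split => t /=.
      move=> [[Bt Ct] Et] k /=; rewrite !inE /A1.
      case: eqP => [->//|_]; case: eqP => [->//|_] /=; exact: Et.
    move=> At; split; last first.
      move=> k /= ks'; move: (ks'); rewrite mem_filter => /andP[/andP[kb kc] ks].
      have := At k; rewrite /A1 (negbTE kb) (negbTE kc); apply.
      by rewrite /= !inE ks' !orbT.
    have := At b; rewrite /A1 eqxx /= !inE eqxx => /(_ isT) ?.
    by have := At c; rewrite /A1 cb eqxx /= !inE eqxx orbT => /(_ isT) ?.
  rewrite XE//; last first.
    by rewrite /= !inE !mem_filter !eqxx (negbTE bc) /= andbF/= filter_uniq.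
  rewrite !big_cons /A1 eqxx cb eqxx pE [RHS]muleC muleA; congr (_ * _).
  apply: eq_big_seq => k; rewrite mem_filter => /andP[/andP[kb kc] _].
  by rewrite (negbTE kb) (negbTE kc).
transitivity (m (phi @^-1` (A0 b `*` A0 c))).
  rewrite /m /= /pushforward /mrestr; congr (P _).
  apply/seteqP; split => t /=.
    move=> At; split.
      split; rewrite /A0; case: ifPn => // ks; have := At _ ks.
        by rewrite /pair_update /= eqxx.
      by rewrite /pair_update /= eq_sym (negbTE bc) eqxx.
    move=> k /=; rewrite mem_filter => /andP[/andP[kb kc] ks].
    by have := At _ ks; rewrite /pair_update /= (negbTE kb) (negbTE kc).
  move=> [[Abt Act] Et] k /= ks; rewrite /pair_update.
  have [kb|kb] := eqVneq k b; first by move: Abt; rewrite /A0 -kb ks.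
  have [kc|kc] := eqVneq k c; first by move: Act; rewrite /A0 -kc ks.
  by apply: Et; rewrite /= mem_filter kb kc.
rewrite (product_law_unique mBC); last first.
  by rewrite -[X in measurable X]setTI; apply: mphi => //; exact: measurableX.
rewrite muphi// pE (bigID (pred1 b)) /= [X in _ = _ * X](bigID (pred1 c)) /=.
rewrite [LHS]muleC -muleA; congr (_ * _); [|congr (_ * _)].
- rewrite /A0; case: ifPn => bs; first by rewrite -big_filter filter_pred1_uniq// big_seq1.
  rewrite probability_setT big1_seq// => k /andP[/eqP-> ks].
  by rewrite ks in bs.
- rewrite (eq_bigl (pred1 c)); last first.
    by move=> k /=; case: eqP => [->|//]; rewrite (negbTE bc).
  rewrite /A0; case: ifPn => bs; first by rewrite -big_filter filter_pred1_uniq// big_seq1.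
  rewrite probability_setT big1_seq// => k /andP[/eqP-> ks].
  by rewrite ks in bs.
- rewrite /p big_filter; apply: eq_bigr => k /andP[kb kc].
  by rewrite mu'E.
Qed.

End independent_families.

(** * The Burke transformation at a single site *)

Section burke.
Context {R : realType} {K : choiceType}.

(* With independent [s a], [s b], [s c] of rates r1 + r2, r1, r2, the three pair
   moves replace (s b, s c) by independent (difference, minimum), then the
   (difference, s a) by two new independent increments at [b] and [a], and
   finally exchange [a] and [c]; every law is preserved. *)
Definition burke_flip (a b c : K) (s : K -> R) : K -> R :=
  pair_update a c (fun p => (p.2, p.1))
    (pair_update b a (@undiff_min R) (pair_update b c (@diff_min R) s)).

Context (a b c : K) (ab : a != b) (ac : a != c) (bc : b != c).

Let ba : (b == a) = false. Proof. by rewrite eq_sym; exact/negbTE. Qed.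
Let ca : (c == a) = false. Proof. by rewrite eq_sym; exact/negbTE. Qed.
Let cb : (c == b) = false. Proof. by rewrite eq_sym; exact/negbTE. Qed.

Lemma burke_flip1 (s : K -> R) :
  burke_flip a b c s b = s a + Num.max (s b - s c) 0.
Proof.
by rewrite /burke_flip /pair_update !eqxx ba ca cb (negbTE ab) (negbTE ac) (negbTE bc).
Qed.

Lemma burke_flip2 (s : K -> R) :
  burke_flip a b c s c = s a + Num.max (s c - s b) 0.
Proof.
rewrite /burke_flip /pair_update !eqxx ca cb (negbTE ab) (negbTE ac) /=.
by rewrite opprB.
Qed.

Lemma burke_flip_id (s : K -> R) k :
  k != a -> k != b -> k != c -> burke_flip a b c s k = s k.
Proof.
by move=> /negbTE ka /negbTE kb /negbTE kc; rewrite /burke_flip /pair_update ka kb kc.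
Qed.

(** The weight at [a] has rate [r1 + r2], exactly the rate of the minimum of the two increments. It
    can therefore replace this minimum, and [undiff_min] rebuilds increments with the original laws,
    while the old minimum becomes an independent new variable. *)
Lemma indep_laws_burke_flip d (T : measurableType d) (P : probability T R)
    (X : K -> T -> R) (mu : K -> probability R R)
    (r1 r2 : R) (r10 : 0 < r1) (r20 : 0 < r2) (r120 : 0 < r1 + r2) :
  mu a = exp_law r120 -> mu b = exp_law r10 -> mu c = exp_law r20 ->
  indep_laws P X mu -> indep_laws P (fun k t => burke_flip a b c (X^~ t) k) mu.
Proof.
move=> mua mub muc iX.
(* [mu1] and [mu2] are the laws after the first and the second pair move. The moves are peeled off
   below from the last to the first. *)
pose mu1 k := if k == b then diff_law r10 r20
  else if k == c then exp_law r120 else mu k.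
pose mu2 k := if k == b then exp_law r10
  else if k == a then exp_law r20 else if k == c then exp_law r120 else mu k.
apply: (@indep_laws_pair_update _ _ _ _ _ _ mu2) => //.
- apply: measurable_fun_pair => //.
- move=> k /negbTE ka /negbTE kc; rewrite /mu2 ka kc.
  by case: eqP => [->|].
- move=> A B mA mB; rewrite /mu2 eqxx (negbTE ab) ca cb eqxx mua muc.
  rewrite (_ : _ @^-1` _ = B `*` A); last first.
    by apply/seteqP; split => -[x y] [].
  by rewrite (product_measure1E _ _ mB mA); exact: muleC.
apply: (@indep_laws_pair_update _ _ _ _ _ _ mu1).
- by rewrite ba.
- exact: measurable_undiff_min.
- by move=> k /negbTE kb /negbTE ka; rewrite /mu1 /mu2 kb ka.
- move=> A B mA mB; rewrite /mu1 /mu2 !eqxx (negbTE ab) (negbTE ac) mua.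
  exact: undiff_min_law.
apply: (@indep_laws_pair_update _ _ _ _ _ _ mu) => //.
- exact: measurable_diff_min.
- by move=> k /negbTE kb /negbTE kc; rewrite /mu1 kb kc.
- move=> A B mA mB; rewrite /mu1 !eqxx cb mub muc.
  exact: diff_min_law.
Qed.

End burke.

(** * Crossing the triangle below the terminal line, one site at a time *)

Section triangle.
Context {R : realType}.

Definition bulk_site (i j : nat) : site := (i%:Z, j%:Z).
Definition row_site (i : nat) : site := (i%:Z, -1).
Definition col_site (j : nat) : site := (-1, j%:Z).

Lemma bulk_row i j i' : (bulk_site i j == row_site i') = false.
Proof. by rewrite /bulk_site /row_site xpair_eqE andbC. Qed.

Lemma bulk_col i j j' : (bulk_site i j == col_site j') = false.
Proof. by rewrite /bulk_site /col_site xpair_eqE. Qed.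

Lemma row_col i j : (row_site i == col_site j) = false.
Proof. by rewrite /row_site /col_site xpair_eqE. Qed.

Lemma bulk_site_eq i j i' j' :
  (bulk_site i j == bulk_site i' j') = (i == i') && (j == j').
Proof. by rewrite /bulk_site xpair_eqE !eqz_nat. Qed.

Lemma row_site_eq i i' : (row_site i == row_site i') = (i == i').
Proof. by rewrite /row_site xpair_eqE eqz_nat andbT. Qed.

Lemma col_site_eq i i' : (col_site i == col_site i') = (i == i').
Proof. by rewrite /col_site xpair_eqE eqz_nat. Qed.

Definition site_eq := (bulk_row, bulk_col, row_col, bulk_site_eq, row_site_eq, col_site_eq,
  fun i j i' => etrans (eq_sym (row_site i') _) (bulk_row i j i'),
  fun i j j' => etrans (eq_sym (col_site j') _) (bulk_col i j j'),
  fun i j => etrans (eq_sym (col_site j) _) (row_col i j)).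

(* State of the field along a down-right path: [row_site i] holds the e1-increment
   at column i, [col_site j] the e2-increment at row j, and [bulk_site i j] the
   weight as long as the site (i, j) has not been crossed. *)
Definition site_flip (i j : nat) : (site -> R) -> site -> R :=
  burke_flip (bulk_site i j) (row_site i) (col_site j).

(** The sites are crossed from the top, [(i, m - 1)], down to [(i, 0)]. *)
Fixpoint column_flip (i m : nat) (s : site -> R) : site -> R :=
  if m is m'.+1 then column_flip i m' (site_flip i m' s) else s.

(** The columns are crossed from right to left, the leftmost having height [c]; every site thus
    comes after its right and upper neighbours in the triangle. *)
Fixpoint triangle_flip (i c : nat) (s : site -> R) : site -> R :=
  if c is c'.+1 then column_flip i c (triangle_flip i.+1 c' s) else s.

Lemma site_flip_row i j s :
  site_flip i j s (row_site i) =
  s (bulk_site i j) + Num.max (s (row_site i) - s (col_site j)) 0.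
Proof. by rewrite /site_flip burke_flip1// site_eq. Qed.

Lemma site_flip_col i j s :
  site_flip i j s (col_site j) =
  s (bulk_site i j) + Num.max (s (col_site j) - s (row_site i)) 0.
Proof. by rewrite /site_flip burke_flip2// site_eq. Qed.

Lemma column_flip_row i i' m s : i' != i ->
  column_flip i m s (row_site i') = s (row_site i').
Proof.
move=> ii'; elim: m s => //= m IH s; rewrite IH.
by rewrite /site_flip burke_flip_id// site_eq.
Qed.

Lemma column_flip_col i j m s : (m <= j)%N ->
  column_flip i m s (col_site j) = s (col_site j).
Proof.
elim: m s => //= m IH s mj; rewrite IH ?(ltnW mj)//.
by rewrite /site_flip burke_flip_id// site_eq// gtn_eqF.
Qed.

Lemma column_flip_bulk i i' j m s : i' != i ->
  column_flip i m s (bulk_site i' j) = s (bulk_site i' j).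
Proof.
move=> ii'; elim: m s => //= m IH s; rewrite IH.
by rewrite /site_flip burke_flip_id// site_eq// (negbTE ii').
Qed.

(** Subtracting [U i.+1 j] or [U i j.+1] from the recursion for [U i j] gives exactly the two
    formulas of [site_flip]. At the top site only the difference of the incoming increments is
    prescribed, because the corner [(i + 1, m)] separating them lies beyond the terminal line. *)
Lemma column_flip_increments (U : nat -> nat -> R) i m s :
  (forall j, (j < m)%N ->
    U i j = s (bulk_site i j) + Num.max (U i.+1 j) (U i j.+1)) ->
  (forall j, j.+1 = m ->
    s (row_site i) - s (col_site j) = U i j.+1 - U i.+1 j) ->
  (forall j, (j.+1 < m)%N -> s (col_site j) = U i.+1 j - U i.+1 j.+1) ->
  ((0 < m)%N -> column_flip i m s (row_site i) = U i 0%N - U i.+1 0%N) /\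
  (forall j, (j < m)%N -> column_flip i m s (col_site j) = U i j - U i j.+1).
Proof.
elim: m s => [|m IH] s HU Hd Hc; first by split.
set s1 := site_flip i m s.
have dm : s (row_site i) - s (col_site m) = U i m.+1 - U i.+1 m by exact: Hd.
have row1 : s1 (row_site i) = U i m - U i.+1 m.
  rewrite /s1 site_flip_row dm (HU m)//.
  by rewrite /Num.max; do 2 case: ifPn; lra.
have col1 : s1 (col_site m) = U i m - U i m.+1.
  rewrite /s1 site_flip_col -opprB dm (HU m)//.
  by rewrite /Num.max; do 2 case: ifPn; lra.
have col1' j : (j < m)%N -> s1 (col_site j) = s (col_site j).
  by move=> jm; rewrite /s1 /site_flip burke_flip_id// site_eq// ltn_eqF.
have [||| rowm colm] := IH s1.
- move=> j jm; rewrite HU ?ltnS 1?ltnW//; congr (_ + _).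
  by rewrite /s1 /site_flip burke_flip_id// site_eq// eqxx ltn_eqF.
(* One site further down, the common term [U i.+1 m] cancels between the new row increment and the
   column increment. *)
- move=> j jm; rewrite row1 col1' -jm// Hc ?jm//; lra.
- by move=> j jm; rewrite (col1' _ (ltnW jm)) Hc// ltnS ltnW.
split=> [_|j].
  change (column_flip i m s1 (row_site i) = U i 0%N - U i.+1 0%N).
  have [m0|m0] := posnP m; last exact: rowm.
  by transitivity (s1 (row_site i)); [rewrite m0|rewrite row1 m0].
rewrite ltnS leq_eqVlt => /predU1P[->|]; last exact: colm.
change (column_flip i m s1 (col_site m) = U i m - U i m.+1).
by rewrite column_flip_col.
Qed.

Lemma triangle_flipS i c s :
  triangle_flip i c.+1 s = column_flip i c.+1 (triangle_flip i.+1 c s).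
Proof. by []. Qed.

Lemma triangle_flip_row i c i' s : (i' < i)%N ->
  triangle_flip i c s (row_site i') = s (row_site i').
Proof.
elim: c i => // c IH i ii'.
rewrite triangle_flipS column_flip_row ?ltn_eqF//.
by rewrite IH// ltnW.
Qed.

Lemma triangle_flip_bulk i c i' j s : (i' < i)%N ->
  triangle_flip i c s (bulk_site i' j) = s (bulk_site i' j).
Proof.
elim: c i => // c IH i ii'.
rewrite triangle_flipS column_flip_bulk ?ltn_eqF//.
by rewrite IH// ltnW.
Qed.

Lemma triangle_flip_col i c j s : (c <= j)%N ->
  triangle_flip i c s (col_site j) = s (col_site j).
Proof.
elim: c i => // c IH i ij.
by rewrite triangle_flipS column_flip_col// IH// ltnW.
Qed.

(** Once columns [i + 1] and beyond are crossed, the column sites carry the vertical increments of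
    [U] along column [i + 1], which is the input needed to cross column [i]. *)
Lemma triangle_flip_increments (U : nat -> nat -> R) n i c s : (i + c)%N = n ->
  (forall i j, (i + j < n)%N ->
    U i j = s (bulk_site i j) + Num.max (U i.+1 j) (U i j.+1)) ->
  (forall i j, (i + j).+1 = n ->
    s (row_site i) - s (col_site j) = U i j.+1 - U i.+1 j) ->
  (forall i', (i <= i' < n)%N ->
    triangle_flip i c s (row_site i') = U i' 0%N - U i'.+1 0%N) /\
  (forall j, (j < c)%N -> triangle_flip i c s (col_site j) = U i j - U i j.+1).
Proof.
move=> + HU Hd; elim: c i => [i|c IH i icn].
  rewrite addn0 => ->; split=> // i' /andP[ni' i'n].
  by have := leq_ltn_trans ni' i'n; rewrite ltnn.
have [|rowi coli] := IH i.+1; first by rewrite -icn addnS.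
set s1 := triangle_flip i.+1 c s in rowi coli *.
rewrite triangle_flipS -/s1.
have [||| rowm colm] := @column_flip_increments U i c.+1 s1.
- move=> j jc; rewrite HU; last by rewrite -icn ltn_add2l.
  by rewrite /s1 triangle_flip_bulk.
(* The top site of the column borders the terminal line, where both boundary variables are still
   untouched. *)
- move=> j [->]; rewrite /s1 triangle_flip_row// triangle_flip_col//.
  by rewrite Hd// -icn addnS.
- by move=> j jc; rewrite coli.
split=> // i' /andP[].
rewrite leq_eqVlt => /predU1P[<- _|ii' i'n]; first exact: rowm.
by rewrite column_flip_row ?gtn_eqF// rowi ?ii'.
Qed.

(** The new row variables telescope along the first axis. The Burke property makes them independent
    exponentials, so the law of large numbers will apply to this difference. *)
Lemma sum_triangle_flip (U : nat -> nat -> R) n s :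
  (forall i j, (i + j < n)%N ->
    U i j = s (bulk_site i j) + Num.max (U i.+1 j) (U i j.+1)) ->
  (forall i j, (i + j).+1 = n ->
    s (row_site i) - s (col_site j) = U i j.+1 - U i.+1 j) ->
  \sum_(k <- map row_site (iota 0 n)) triangle_flip 0 n s k = U 0%N 0%N - U n 0%N.
Proof.
move=> HU Hd; have [rowE _] := triangle_flip_increments (add0n n) HU Hd.
rewrite big_map -{1}[n]subn0 -/(index_iota 0 n).
rewrite (eq_big_nat _ _ (F2 := fun i => - (U i.+1 0%N - U i 0%N))).
  by rewrite sumrN telescope_sumr// opprB.
by move=> i i_n; rewrite opprB rowE.
Qed.

End triangle.

(** * Law of large numbers for triangular arrays of exponential variables *)

Section weighted.
Local Open Scope ereal_scope.
Import HBNNSimple.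

(** A change of variables with weight [Y], proved by simple approximation of [g]. It serves both to
    integrate against a density and to split off one factor of an independent product. *)
Lemma ge0_integral_weighted d d' (T : measurableType d) (T' : measurableType d')
    (R : realType) (m : {measure set T -> \bar R}) (nu : {measure set T' -> \bar R})
    (X : T -> T') (Y : T -> R) (g : T' -> R) :
  measurable_fun setT X -> measurable_fun setT Y -> (forall t, 0 <= Y t)%R ->
  (forall A, measurable A -> \int[m]_(t in X @^-1` A) (Y t)%:E = nu A) ->
  measurable_fun setT g -> (forall x, 0 <= g x)%R ->
  \int[m]_t (Y t * g (X t))%:E = \int[nu]_x (g x)%:E.
Proof.
move=> mX mY Y0 XY mg g0.
have mEg : measurable_fun setT (EFin \o g) by exact/measurable_EFinP.
pose h := nnsfun_approx measurableT mEg.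
have hg x : (h n x)%:E @[n --> \oo] --> (g x)%:E.
  by apply: (@cvg_nnsfun_approx _ _ _ _ measurableT (EFin \o g) mEg) => //= y _; rewrite lee_fin.
have nd_h x : nondecreasing_seq (fun n => h n x).
  by move=> a b ab; exact/lefP/nd_nnsfun_approx.
have -> : \int[nu]_x (g x)%:E = limn (fun n => \int[nu]_x (h n x)%:E).
  rewrite -monotone_convergence//.
  - by apply: eq_integral => x _; apply/esym/cvg_lim.
  - by move=> n; exact/measurable_EFinP.
  - by move=> n x _; rewrite lee_fin.
  - by move=> x _ a b ab; rewrite lee_fin nd_h.
have -> : \int[m]_t (Y t * g (X t))%:E =
    limn (fun n => \int[m]_t (Y t * h n (X t))%:E).
  rewrite -monotone_convergence//.
  - apply: eq_integral => t _; apply/esym/cvg_lim => //.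
    have := @cvgeZl _ _ R (fun n => (h n (X t))%:E) _ (Y t)%:E isT (hg (X t)).
    exact.
  - move=> n; apply/measurable_EFinP; apply: measurable_funM => //.
    exact: measurableT_comp.
  - by move=> n x _; rewrite lee_fin mulr_ge0.
  - by move=> x _ a b ab; rewrite lee_fin ler_wpM2l// nd_h.
(* For a simple function, linearity reduces the claim to indicators, where it is the hypothesis
   [XY]. *)
congr (limn _); apply/funext => n.
have mhy y : measurable (h n @^-1` [set y]).
  by rewrite -[X in measurable X]setTI; exact: measurable_funP.
have mhXy y : measurable (X @^-1` (h n @^-1` [set y])).
  by rewrite -[X in measurable X]setTI; exact: mX.
transitivity (\int[m]_t \sum_(y \in range (h n))
    (Y t * (y * \1_(h n @^-1` [set y]) (X t)))%:E).
  by apply: eq_integral => t _; rewrite (fimfunE (h n)) fsumEFin// mulr_fsumr.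
transitivity (\int[nu]_x \sum_(y \in range (h n))
    (y * \1_(h n @^-1` [set y]) x)%:E); last first.
  by apply: eq_integral => x _; rewrite (fimfunE (h n)) fsumEFin.
have mind y : measurable_fun setT (fun x : T' => \1_(h n @^-1` [set y]) x : R).
  exact: measurable_indic.
have mindX y : measurable_fun setT
    (fun t => \1_(h n @^-1` [set y]) (X t) : R).
  exact: measurableT_comp (mind y) mX.
rewrite ge0_integral_fsum//; last 2 first.
- move=> y; apply/measurable_EFinP; apply: measurable_funM => //.
  exact: measurable_funM.
- move=> y t _; rewrite EFinM mule_ge0 ?lee_fin//.
  by have := nnfun_muleindic_ge0 (h n) y (X t); rewrite lee_fin.
rewrite ge0_integral_fsum//; last 2 first.
- by move=> y; apply/measurable_EFinP; exact: measurable_funM.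
- by move=> y x _; exact: nnfun_muleindic_ge0.
apply: eq_fsbigr => y; rewrite inE => -[x0 _ yE].
have y0 : 0 <= y%:E by rewrite -yE lee_fin.
under eq_integral do rewrite mulrCA EFinM.
rewrite ge0_integralZl//; last 2 first.
- by apply/measurable_EFinP; exact: measurable_funM.
- by move=> t _; rewrite lee_fin mulr_ge0.
under [RHS]eq_integral do rewrite EFinM.
rewrite ge0_integralZl//; last by apply/measurable_EFinP; exact: mind.
rewrite integral_indic// setIT -XY//; congr (_ * _).
rewrite [RHS]integral_mkcond; apply: eq_integral => t _.
rewrite restrict_EFin /= patchE indicE -[X t \in _]/(t \in X @^-1` _).
by case: ifP => _; rewrite ?mulr1 ?mulr0.
Qed.

End weighted.

(** * Exponential moments and Chernoff bounds *)

Section exponential_moments.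
Context {R : realType}.
Local Open Scope ereal_scope.

(** Tilting the rate [r] density by [exp(u r x)] gives [1 / (1 - u)] times the density of rate
    [(1 - u) r]. *)
Lemma exp_law_mgf (r u : R) (r0 : (0 < r)%R) : (u < 1)%R ->
  \int[exp_law r0]_x (expR (u * r * x))%:E = ((1 - u)^-1)%:E.
Proof.
move=> u1; have u10 : (0 < 1 - u)%R by rewrite subr_gt0.
have ru0 : (0 < (1 - u) * r)%R by exact: mulr_gt0.
have mexp : measurable_fun setT (fun x : R => expR (u * r * x)).
  by apply: measurableT_comp => //; exact: measurable_funM.
have mid : measurable_fun setT (idfun : measurableTypeR R -> R).
  exact: measurable_id.
have <- := @ge0_integral_weighted _ _ _ _ R lebesgue_measure (exp_law r0)
  (idfun : measurableTypeR R -> R) (exponential_pdf r) _ mid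
  (measurable_exponential_pdf r) (exponential_pdf_ge0 (ltW r0))
  (fun A _ => erefl) mexp (fun x => expR_ge0 _).
transitivity (\int[lebesgue_measure]_x
    (((1 - u)^-1)%:E * (exponential_pdf ((1 - u) * r) x)%:E)).
  apply: eq_integral => x _ /=; rewrite -EFinM; congr EFin.
  have [x0|x0] := ltP x 0%R; first by rewrite !lt0_exponential_pdf// mul0r mulr0.
  rewrite !exponential_pdfE// -mulrA -expRD mulrA mulrA mulVf ?gt_eqF// mul1r.
  by congr (_ * expR _)%R; ring.
rewrite ge0_integralZl//.
- by rewrite integral_exponential_pdf// mule1.
- by apply/measurable_EFinP; exact: measurable_exponential_pdf.
- by move=> x _; rewrite lee_fin exponential_pdf_ge0// ltW.
- by rewrite lee_fin invr_ge0 ltW.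
Qed.

Context d (T : measurableType d) (P : probability T R) (K : choiceType).
Implicit Types (X : K -> T -> R) (mu : K -> probability R R).

(** The event over [s2] makes the induction on [s] work: a variable [k] moves from the product to
    the event, and the induction hypothesis over all Borel sets [B] for [X k] supplies the weighted
    measure for [ge0_integral_weighted]. *)
Lemma indep_laws_integral_prod X mu (g : R -> R) (M : R) (s s2 : seq K)
    (A : K -> set R) : indep_laws P X mu ->
  measurable_fun setT g -> (forall x, 0 <= g x)%R -> (0 <= M)%R ->
  (forall k, k \in s -> \int[mu k]_x (g x)%:E = M%:E) ->
  uniq (s ++ s2) -> (forall k, measurable (A k)) ->
  \int[P]_(t in \bigcap_(k in [set` s2]) X k @^-1` A k)
      (\prod_(k <- s) g (X k t))%:E =
  (M ^+ size s)%:E * \prod_(k <- s2) mu k (A k).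
Proof.
move=> [mX XE] mg g0 M0; elim: s s2 A => [|k s IH] s2 A gM us mA.
  under eq_integral do rewrite big_nil.
  rewrite integral_cst ?XE//; last exact: measurable_bigcap_seq.
  by congr (_ * _); exact: XE.
set E := \bigcap_(i in _) _.
have mE : measurable E by exact: measurable_bigcap_seq.
have ks2 : k \notin s2.
  by move: us; rewrite /= mem_cat negb_or => /andP[/andP[]].
have us2 : uniq s2 by move: us; rewrite cat_uniq => /and3P[].
set p := \prod_(k <- s2) mu k (A k).
have PE : P E = p by apply: XE => //; exact: filter_uniq.
have p0 : (0 <= M ^+ size s * fine p)%R.
  by rewrite mulr_ge0 ?exprn_ge0// fine_ge0// -PE.
have pE : (fine p)%:E = p by rewrite fineK// -PE fin_num_measure.
have mgX i : measurable_fun setT (fun t => g (X i t)).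
  exact: measurableT_comp mg (mX i).
have mprod : measurable_fun setT (fun t => (\prod_(i <- s) g (X i t))%R).
  by apply: measurable_prod => i _.
pose Y t := (\prod_(i <- s) g (X i t) * \1_E t)%R.
have mY : measurable_fun setT Y.
  by apply: measurable_funM => //; exact: measurable_indic.
have Y0 t : (0 <= Y t)%R by rewrite mulr_ge0// prodr_ge0.
have YE B : measurable B ->
    \int[P]_(t in X k @^-1` B) (Y t)%:E = mscale (NngNum p0) (mu k) B.
  move=> mB; pose A1 i := if i == k then B else A i.
  have mA1 i : measurable (A1 i) by rewrite /A1; case: ifP.
  transitivity (\int[P]_(t in \bigcap_(i in [set` k :: s2]) X i @^-1` A1 i)
      (\prod_(i <- s) g (X i t))%:E).
    rewrite (_ : \bigcap_(i in _) _ = X k @^-1` B `&` E); last first.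
      rewrite /E !bigcap_seq big_cons /A1 eqxx; congr (_ `&` _).
      apply: eq_big_seq => i is2; case: eqP => // ik.
      by rewrite -ik is2 in ks2.
    rewrite integral_mkcond [RHS]integral_mkcond; apply: eq_integral => t _.
    rewrite !restrict_EFin /= !patchE in_setI /Y indicE.
    by case: (t \in X k @^-1` B) => //=; case: (t \in E); rewrite ?mulr1 ?mulr0.
  rewrite IH//; last 2 first.
  - by move=> i si; apply: gM; rewrite inE si orbT.
  - by rewrite -(perm_uniq (permEl (perm_catCA [:: k] s s2))).
  rewrite big_cons (_ : \prod_(j <- s2) mu j (A1 j) = p); last first.
    apply: eq_big_seq => i is2; rewrite /A1; case: eqP => // ik.
    by rewrite -ik is2 in ks2.
  by rewrite /mscale /= EFinM pE {1}/A1 eqxx [mu k B * p]muleC muleA.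
transitivity (\int[P]_t (Y t * g (X k t))%:E).
  rewrite integral_mkcond; apply: eq_integral => t _.
  rewrite restrict_EFin /= patchE /Y indicE big_cons.
  by case: (t \in E); rewrite ?mulr1 ?mulr0 ?mul0r// mulrC.
rewrite (ge0_integral_weighted (mX k) mY Y0 YE mg g0).
rewrite ge0_integral_mscale//; last 2 first.
- exact/measurable_EFinP.
- by move=> x _; rewrite lee_fin.
rewrite gM ?inE ?eqxx//= EFinM pE [_ * M%:E]muleC muleA -EFinM -exprS.
by [].
Qed.

(** Markov's inequality for the exponential of the sum. A negative [u] gives the lower tail. *)
Lemma indep_exp_tail X mu (r u b : R) (r0 : (0 < r)%R) (s : seq K) :
  (u < 1)%R -> indep_laws P X mu -> uniq s ->
  (forall k, k \in s -> mu k = exp_law r0) ->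
  P [set t | (b <= u * r * \sum_(k <- s) X k t)%R] <=
  (expR (- b) * (1 - u)^-1 ^+ size s)%:E.
Proof.
move=> u1 iX us muE.
have mS : measurable_fun setT (fun t => \sum_(k <- s) X k t)%R.
  by apply: measurable_sum => k; exact: iX.1.
have mexp : measurable_fun setT (fun x : R => expR (u * r * x)).
  by apply: measurableT_comp => //; exact: measurable_funM.
set E := [set t | _].
have mE : measurable E.
  rewrite /E (_ : mkset _ = (fun t => u * r * \sum_(k <- s) X k t)%R @^-1` `[b, +oo[); last first.
    by apply/seteqP; split => t /=; rewrite in_itv /= andbT.
  rewrite -[X in measurable X]setTI.
  have : measurable_fun setT (fun t => u * r * \sum_(k <- s) X k t)%R.
    exact: measurable_funM.
  by apply.
have iE : \int[P]_t (expR (u * r * \sum_(k <- s) X k t))%:E =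
    ((1 - u)^-1 ^+ size s)%:E.
  have M0 : (0 <= (1 - u)^-1)%R by rewrite invr_ge0 subr_ge0 ltW.
  have /= := @indep_laws_integral_prod X mu (fun x => expR (u * r * x))
    (1 - u)^-1 s [::] (fun=> setT) iX mexp (fun x => expR_ge0 _) M0.
  rewrite big_nil mule1 bigcap_seq big_nil => <- //.
  - by apply: eq_integral => t _; rewrite mulr_sumr expR_sum.
  - by move=> k ks; rewrite muE// exp_law_mgf.
  - by rewrite cats0.
rewrite EFinM -iE.
have eb : (expR (- b))%:E * (expR b)%:E = 1 :> \bar R.
  by rewrite -EFinM -expRD addNr expR0.
rewrite -[leLHS]mul1e -eb -muleA lee_wpmul2l ?lee_fin ?expR_ge0//.
rewrite -integral_cst//.
apply: (@le_trans _ _ (\int[P]_(t in E) (expR (u * r * \sum_(k <- s) X k t))%:E)).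
  apply: ge0_le_integral => //.
  - by move=> t _; rewrite lee_fin expR_ge0.
  - apply/measurable_EFinP; apply: measurable_funTS.
    exact: measurableT_comp mexp mS.
  - by move=> t Et; rewrite lee_fin ler_expR.
apply: ge0_subset_integral => //.
by apply/measurable_EFinP; exact: measurableT_comp mexp mS.
Qed.

End exponential_moments.

(** * Borel-Cantelli and the strong law *)

Section law_of_large_numbers.
Context {R : realType} d (T : measurableType d) (P : probability T R).

Lemma ae_eventually_not (F : nat -> set T) (q : R) : 0 <= q -> q < 1 ->
  (forall n, measurable (F n)) -> (forall n, (P (F n) <= (q ^+ n)%:E)%E) ->
  {ae P, forall t, \forall n \near \oo, ~ F n t}.
Proof.
move=> q0 q1 mF PF; exists (lim_sup_set F); split.
- by apply: bigcap_measurable => // n _; exact: bigcup_measurable.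
- apply: lim_sup_set_cvg0 => //.
  apply: (@le_lt_trans _ _ ((1 - q)^-1)%:E); last exact: ltry.
  apply: lime_le; first exact: is_cvg_nneseries.
  apply: nearW => n.
  apply: (@le_trans _ _ (\sum_(0 <= i < n) (q ^+ i)%:E)%E).
    by apply: lee_sum => i _; exact: PF.
  rewrite sumEFin lee_fin big_mkord -[leRHS]mul1r ler_pdivlMr ?subr_gt0//.
  by rewrite mulrC -opprB mulNr -subrX1 opprB gerBl exprn_ge0.
move=> t /= H n _; apply: contrapT => Fn; apply: H.
exists n => // k /= nk Fkt; apply: Fn; exists k => //.
Qed.

(** [q] is the Chernoff factor per variable at level [1 + e]. The tilt [u = e / w] has the sign of
    [e], so one choice treats both tails, and [w] is large enough to keep [u] below one. *)
Lemma chernoff_rate (e : R) : e != 0 ->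
  exists u q : R, [/\ 0 < u * e, u < 1, 0 <= q, q < 1 &
    expR (- (u * (1 + e))) / (1 - u) = q].
Proof.
move=> e0; pose w := 2 * (1 + `|e|); pose u := e / w.
have w0 : 0 < w by rewrite mulr_gt0// ltr_wpDr.
have eE : e = u * w by rewrite /u divfK// gt_eqF.
have ew : 1 + e < w by rewrite /w; have := ler_norm e; have := normr_ge0 e; lra.
have u0 : u != 0 by apply: contra_neq e0 => u0; rewrite eE u0 mul0r.
have u2 : 0 < u ^+ 2 by rewrite exprn_even_gt0.
have u1 : u < 1.
  by rewrite /u ltr_pdivrMr// mul1r (lt_trans _ ew)// ltrDr.
exists u, (expR (- (u * (1 + e))) / (1 - u)); split => //.
- by rewrite eE mulrA -expr2 mulr_gt0.
- by rewrite divr_ge0 ?expR_ge0// subr_ge0 ltW.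
(* By [1 + x <= expR x] it suffices that [(1 + u (1 + e)) (1 - u) > 1], that is
   [u^2 (1 + e) < u e = u^2 w]. *)
- rewrite ltr_pdivrMr ?subr_gt0// mul1r expRN invf_plt ?posrE ?expR_gt0 ?subr_gt0//.
  apply: (lt_le_trans _ (expR_ge1Dx _)).
  rewrite -div1r ltr_pdivrMr ?subr_gt0//.
  rewrite (_ : (1 + u * (1 + e)) * (1 - u) = 1 + (u * e - u ^+ 2 * (1 + e))); last by ring.
  rewrite ltrDl subr_gt0 [X in u * X]eE mulrA -expr2.
  by rewrite ltr_pM2l.
Qed.

Context {K : choiceType} (X : nat -> K -> T -> R)
  (mu : nat -> K -> probability R R) (s : nat -> seq K) (r : R) (r0 : 0 < r).
Hypothesis iX : forall n, indep_laws P (X n) (mu n).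
Hypothesis us : forall n, uniq (s n).
Hypothesis ss : forall n, size (s n) = n.
Hypothesis muE : forall n k, k \in s n -> mu n k = exp_law r0.

Let S n t := \sum_(k <- s n) X n k t.

(** The factor [e] on both sides encodes the direction: an upper bound on [r S n] for [e > 0], a
    lower bound for [e < 0]. *)
Lemma ae_exp_deviation (e : R) : e != 0 ->
  {ae P, forall t, \forall n \near \oo, e * (r * S n t) < e * (n%:R * (1 + e))}.
Proof.
move=> /chernoff_rate[u [q [ue0 u1 q0 q1 qE]]].
pose F n := [set t | n%:R * (u * (1 + e)) <= u * r * S n t].
have mS n : measurable_fun setT (S n).
  by apply: measurable_sum => k; exact: (iX n).1.
have mF n : measurable (F n).
  rewrite /F (_ : mkset _ =
    (fun t => u * r * S n t) @^-1` `[n%:R * (u * (1 + e)), +oo[%classic); last first.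
    by apply/seteqP; split => t /=; rewrite in_itv /= andbT.
  rewrite -[X in measurable X]setTI.
  have : measurable_fun setT (fun t => u * r * S n t) by exact: measurable_funM.
  by apply.
have PF n : (P (F n) <= (q ^+ n)%:E)%E.
  have := indep_exp_tail (n%:R * (u * (1 + e))) u1 (iX n) (us n) (@muE n).
  by rewrite ss -mulrN expRM_natl -exprMn qE.
have := ae_eventually_not q0 q1 mF PF.
apply: filterS => t; apply: filterS => n /negP; rewrite -ltNge => Fnt.
have : u * (r * S n t) < u * (n%:R * (1 + e)) by rewrite mulrA mulrCA.
have [u0|u0|u0] := ltgtP u 0; last by rewrite u0 mul0r ltxx in ue0.
  have e0 : e < 0 by rewrite nmulr_rgt0 in ue0.
  by rewrite (ltr_nM2l u0) (ltr_nM2l e0).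
have e0 : 0 < e by rewrite pmulr_rgt0 in ue0.
by rewrite (ltr_pM2l u0) (ltr_pM2l e0).
Qed.

(** Deviations at the countably many levels [1 / (m + 1)] and their opposites are excluded
    simultaneously. The family may change with [n], since Borel-Cantelli uses only the law of each
    sum. *)
Lemma exp_law_of_large_numbers :
  {ae P, forall t, n%:R^-1 * S n t @[n --> \oo] --> r^-1}.
Proof.
pose e m : R := m.+1%:R^-1.
have e0 m : 0 < e m by rewrite invr_gt0.
have eN0 m : e m != 0 by rewrite gt_eqF.
have NeN0 m : - e m != 0 by rewrite oppr_eq0.
have := ae_foralln (fun m => ae_exp_deviation (eN0 m)).
have := ae_foralln (fun m => ae_exp_deviation (NeN0 m)).
apply: filterS2 => t lo hi; apply/cvgrPdist_lt => eps eps0.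
have [m em] : exists m, e m < r * eps.
  have [m mE] := ltr_add_invr (mulr_gt0 r0 eps0).
  by exists m; rewrite add0r in mE.
near=> n.
have n0 : 0 < n%:R :> R by rewrite ltr0n; near: n; exists 1%N.
have hin : e m * (r * S n t) < e m * (n%:R * (1 + e m)).
  by near: n; exact: hi.
have lon : - e m * (r * S n t) < - e m * (n%:R * (1 + - e m)).
  by near: n; exact: lo.
rewrite (ltr_pM2l (e0 m)) in hin; rewrite (ltr_nM2l _) ?oppr_lt0// in lon.
set x := S n t in hin lon *.
have xE : r * x = n%:R * (r * (n%:R^-1 * x)).
  by rewrite mulrCA mulVKf// gt_eqF.
rewrite xE !(ltr_pM2l n0) in hin lon.
set y := n%:R^-1 * x in hin lon *.
have rV : r * r^-1 = 1 by rewrite divff// gt_eqF.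
rewrite -(ltr_pM2l r0) -[X in X * `|_|]gtr0_norm// -normrM mulrBr rV.
rewrite ltr_norml; apply/andP; split; lra.
Unshelve. all: by end_near. Qed.

End law_of_large_numbers.

(** * Comparison with the stationary model *)

(** Indices beyond some [N] are controlled by the convergence; the finitely many others contribute
    at most a constant [C], absorbed once [e n >= C]. *)
Lemma cesaro_uniform {R : realType} (S : nat -> R) (l : R) :
  n%:R^-1 * S n @[n --> \oo] --> l ->
  forall e, 0 < e ->
    \forall n \near \oo, forall i, (i <= n)%N -> `|S i - l * i%:R| <= e * n%:R.
Proof.
move=> Sl e e0.
have /cvgrPdist_lt/(_ e e0)[N _ HN] := Sl.
pose C := \sum_(i < N.+1) `|S i - l * i%:R|.
have [M CM] : exists M : nat, C / e <= M%:R.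
  exists (Num.bound `|C / e|).
  exact: le_trans (ler_norm _) (ltW (archi_boundP (normr_ge0 _))).
exists M => // n /= Mn i i_n; have [iN|Ni] := ltnP i N.+1.
  apply: (@le_trans _ _ C).
    rewrite /C (bigD1 (Ordinal iN)) //= lerDl sumr_ge0//.
  rewrite mulrC -ler_pdivrMr// (le_trans CM)// ler_nat//.
have i0 : 0 < i%:R :> R by rewrite ltr0n (leq_ltn_trans _ Ni).
apply: (@le_trans _ _ (e * i%:R)); last by rewrite ler_pM2l// ler_nat.
rewrite (_ : S i - l * i%:R = (i%:R^-1 * S i - l) * i%:R); last first.
  by rewrite mulrBl [_ * S i]mulrC divfK ?gt_eqF.
rewrite normrM (gtr0_norm i0) ler_wpM2r ?ltW// distrC.
exact: HN (ltnW Ni).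
Qed.

Section last_passage_recursion.
Context {R : realType}.
Implicit Types (w : nat -> nat -> R) (F : nat -> nat -> R).

(** [m] counts the remaining steps and [F] is the terminal value. *)
Fixpoint last_passage w F (m i j : nat) : R :=
  if m is m'.+1
  then w i j + Num.max (last_passage w F m' i.+1 j) (last_passage w F m' i j.+1)
  else F i j.

(** Adding a weight and taking a maximum are nonexpansive for the uniform norm. *)
Lemma last_passage_lipschitz w F F' (c : R) n :
  (forall i j, (i + j)%N = n -> `|F i j - F' i j| <= c) ->
  forall m i j, (i + j + m)%N = n ->
    `|last_passage w F m i j - last_passage w F' m i j| <= c.
Proof.
move=> FF'; elim=> [|m IH] i j ijn /=; first by apply: FF'; rewrite -ijn addn0.
have := IH i j.+1; rewrite addnS addSn -addnS => /(_ ijn).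
have := IH i.+1 j; rewrite !addSn -addnS => /(_ ijn).
rewrite !ler_norml => /andP[? ?] /andP[? ?].
by rewrite /Num.max; do 2 case: ifPn; lra.
Qed.

(** Paths are decomposed at their first step, with a general starting site: [upper] bounds every
    path weight by the recursion, and [lower] builds a path attaining it. *)
Lemma point_to_line_last_passage (w : site -> R) n h :
  point_to_line w n h =
  last_passage (fun i j => w (bulk_site i j))
    (fun i j => dot h (bulk_site i j)) n 0 0.
Proof.
set L := last_passage _ _.
have bulk1 i j : bulk_site i j + e1 = bulk_site i.+1 j.
  by rewrite /bulk_site /e1; congr pair; rewrite /= ?addr0// -addn1 PoszD.
have bulk2 i j : bulk_site i j + e2 = bulk_site i j.+1.
  by rewrite /bulk_site /e2; congr pair; rewrite /= ?addr0// -addn1 PoszD.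
have upper m : forall i j (x : nat -> site), x 0%N = bulk_site i j ->
    (forall k, (k < m)%N -> x k.+1 - x k = e1 \/ x k.+1 - x k = e2) ->
    path_weight w h m x <= L m i j.
  elim: m => [|m IH] i j x x0 xS.
    by rewrite /path_weight big_ord0 add0r x0.
  rewrite /path_weight big_ord_recl /= x0 -addrA lerD2l le_max.
  have := xS 0%N isT; rewrite x0 => -[/(canRL (subrK _))|/(canRL (subrK _))] x1.
    apply/orP; left; apply: (IH i.+1 j (fun k => x k.+1)) => [|k km].
      by rewrite x1 addrC bulk1.
    exact: xS.
  apply/orP; right; apply: (IH i j.+1 (fun k => x k.+1)) => [|k km].
    by rewrite x1 addrC bulk2.
  exact: xS.
have lower m : forall i j, exists x : nat -> site, [/\ x 0%N = bulk_site i j,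
    (forall k, (k < m)%N -> x k.+1 - x k = e1 \/ x k.+1 - x k = e2) &
    L m i j = path_weight w h m x].
  elim: m => [|m IH] i j.
    by exists (fun=> bulk_site i j); split; rewrite // /path_weight big_ord0 add0r.
  have step (i' j' : nat) (x : nat -> site) : x 0%N = bulk_site i' j' ->
      bulk_site i' j' - bulk_site i j = e1 \/ bulk_site i' j' - bulk_site i j = e2 ->
      (forall k, (k < m)%N -> x k.+1 - x k = e1 \/ x k.+1 - x k = e2) ->
      exists y : nat -> site, [/\ y 0%N = bulk_site i j,
        (forall k, (k < m.+1)%N -> y k.+1 - y k = e1 \/ y k.+1 - y k = e2) &
        path_weight w h m.+1 y = w (bulk_site i j) + path_weight w h m x].
    move=> x0 d xS; exists (fun k => if k is k'.+1 then x k' else bulk_site i j).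
    split=> [//|[_|k km]|]; first by rewrite x0.
      exact: xS.
    by rewrite /path_weight big_ord_recl /= -addrA.
  have [x [x0 xS xE]] := IH i.+1 j; have [y [y0 yS yE]] := IH i j.+1.
  rewrite /L /= -/L /Num.max; case: ifP => _.
    have [|z [z0 zS zE]] := step i j.+1 y y0 _ yS.
      by right; rewrite -bulk2 addrC addKr.
    by exists z; rewrite zE yE.
  have [|z [z0 zS zE]] := step i.+1 j x x0 _ xS.
    by left; rewrite -bulk1 addrC addKr.
  by exists z; rewrite zE xE.
have [[x [x0 xS] ->] ub] := point_to_line_attained w n h.
apply/eqP; rewrite eq_le upper//=.
by have [y [y0 yS ->]] := lower n 0%N 0%N; apply: ub.
Qed.

End last_passage_recursion.

(** * The stationary field of bulk weights and boundary increments *)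

Section stationary_field.
Context {R : realType} (a b : R) (a0 : 0 < a) (b0 : 0 < b) (ab0 : 0 < a + b).

Definition stationary_rate (k : site) : R :=
  if k.2 < 0 then a else if k.1 < 0 then b else a + b.

Lemma stationary_rate_gt0 k : 0 < stationary_rate k.
Proof. by rewrite /stationary_rate; case: ifP => // _; case: ifP. Qed.

Definition stationary_law (k : site) : probability R R :=
  exp_law (stationary_rate_gt0 k).

Lemma stationary_law_bulk i j : stationary_law (bulk_site i j) = exp_law ab0.
Proof. exact: exp_law_eq. Qed.

Lemma stationary_law_row i : stationary_law (row_site i) = exp_law a0.
Proof. exact: exp_law_eq. Qed.

Lemma stationary_law_col j : stationary_law (col_site j) = exp_law b0.
Proof. exact: exp_law_eq. Qed.

Context d (T : measurableType d) (P : probability T R).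

Lemma indep_laws_triangle_flip i c (X : site -> T -> R) :
  indep_laws P X stationary_law ->
  indep_laws P (fun k t => triangle_flip i c (X^~ t) k) stationary_law.
Proof.
have flip1 i' j (Y : site -> T -> R) : indep_laws P Y stationary_law ->
    indep_laws P (fun k t => site_flip i' j (Y^~ t) k) stationary_law.
  apply: (@indep_laws_burke_flip R _ _ _ _ _ _ _ _ _ P Y _ a b a0 b0 ab0); rewrite ?site_eq//.
  - exact: stationary_law_bulk.
  - exact: stationary_law_row.
  - exact: stationary_law_col.
have flipm i' m (Y : site -> T -> R) : indep_laws P Y stationary_law ->
    indep_laws P (fun k t => column_flip i' m (Y^~ t) k) stationary_law.
  elim: m Y => // m IH Y iY.
  exact: (IH (fun k t => site_flip i' m (Y^~ t) k)) (flip1 _ _ _ iY).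
move=> iX; elim: c i => // c IH i.
exact: (flipm i c.+1 (fun k t => triangle_flip i.+1 c (X^~ t) k)) (IH _).
Qed.

Lemma indep_laws_stationary (omega : site -> {RV P >-> R}) :
  mutually_independent omega ->
  (forall x, exponentially_distributed 1 (omega x)) ->
  indep_laws P (fun k t => (stationary_rate k)^-1 * omega k t) stationary_law.
Proof.
move=> oi oe.
have mr k : measurable_fun setT (fun x : R => (stationary_rate k)^-1 * x).
  exact: measurable_funM.
split=> [k|s A us mA]; first exact: measurable_funM.
pose B k := (fun x : R => (stationary_rate k)^-1 * x) @^-1` A k.
have mB k : measurable (B k).
  by rewrite -[X in measurable X]setTI; exact: mr.
have sE : [set` s] = [set` (seq_fset tt s)].
  have memE := seq_fsetE tt s.
  by apply/seteqP; split => k /=; rewrite memE.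
transitivity (P (\bigcap_(i in [set` seq_fset tt s]) (omega i @^-1` B i))).
  by rewrite sE.
rewrite oi//.
rewrite (perm_big s) /=; last first.
  by apply: uniq_perm => // k; rewrite seq_fsetE.
apply: eq_bigr => k _.
transitivity (exponential_prob 1 (B k)); first exact: oe.
exact: (exp_law_scale (stationary_rate_gt0 k) (mA k)).
Qed.

End stationary_field.

(* [A] and [B] are the mean increments of the stationary field along [e1] and [e2]. *)
Lemma stationary_parameters {R : realType} (h : R * R)
    (A := g_pl h - h.1) (B := g_pl h - h.2) :
  [/\ 0 < A, 0 < B & A^-1 + B^-1 = 1].
Proof.
pose D := h.1 - h.2; pose s := Num.sqrt (D ^+ 2 + 4).
have s2 : s ^+ 2 = D ^+ 2 + 4 by rewrite sqr_sqrtr// addr_ge0 ?sqr_ge0.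
have s0 : 0 <= s := sqrtr_ge0 _.
have gE : g_pl h = 1 + (h.1 + h.2) / 2 + 1 / 2 * s by [].
have AE : A = (2 - D + s) / 2 by rewrite /A gE /D; field.
have BE : B = (2 + D + s) / 2 by rewrite /B gE /D; field.
have A0 : 0 < A by rewrite AE; nra.
have B0 : 0 < B by rewrite BE; nra.
split => //.
(* Both sides equal [2 + s], as [(2 + s)^2 - D^2 = 8 + 4 s]. *)
have AB : A * B = A + B by rewrite AE BE; nra.
rewrite -[LHS](mulfK (x := A * B)) ?mulf_neq0 ?gt_eqF//.
rewrite mulrDl [in X in X + _]mulrA mulVf ?gt_eqF// mul1r.
by rewrite mulrCA mulVf ?gt_eqF// mulr1 addrC -AB divff// mulf_neq0 ?gt_eqF.
Qed.

(** A deterministic comparison. Replacing the terminal values costs [2 e]; then [U 0 0 - t n] is the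
    flipped row sum minus [SI n], each within [e] of [A n]. *)
Lemma point_to_line_stationary {R : realType} (w : site -> R) (A B t : R)
    (s : site -> R) (h : R * R) (n : nat) (e : R) :
  h.1 = t - A -> h.2 = t - B ->
  (forall i j, s (bulk_site i j) = w (bulk_site i j)) ->
  let SI i := \sum_(k <- map row_site (iota 0 i)) s k in
  let SJ j := \sum_(k <- map col_site (iota 0 j)) s k in
  (forall i, (i <= n)%N -> `|SI i - A * i%:R| <= e) ->
  (forall j, (j <= n)%N -> `|SJ j - B * j%:R| <= e) ->
  `|\sum_(k <- map row_site (iota 0 n)) triangle_flip 0 n s k - A * n%:R| <= e ->
  `|point_to_line w n h - t * n%:R| <= 4 * e.
Proof.
move=> h1 h2 sw SI SJ SIe SJe SFe.
(* Moving along the terminal line from [(i + 1, j)] to [(i, j + 1)] changes [F] by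
   [s (row_site i) - s (col_site j)], as the flips require. *)
pose F i j := t * n%:R - SI i - SJ j.
pose W i j := w (bulk_site i j).
pose U i j := last_passage W F (n - i - j) i j.
have SIS i : SI i.+1 = SI i + s (row_site i).
  by rewrite /SI -addn1 iotaD map_cat big_cat /= big_seq1 add0n.
have SJS j : SJ j.+1 = SJ j + s (col_site j).
  by rewrite /SJ -addn1 iotaD map_cat big_cat /= big_seq1 add0n.
have UF i j : (i + j)%N = n -> U i j = F i j.
  by move=> ijn; rewrite /U -subnDA ijn subnn.
have /(sum_triangle_flip (s := s)) sumU : forall i j, (i + j < n)%N ->
    U i j = s (bulk_site i j) + Num.max (U i.+1 j) (U i j.+1).
  move=> i j ijn; rewrite sw /U -!subnDA addSn addnS.
  by rewrite -[(n - (i + j))%N]prednK ?subn_gt0//= -subnS.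
have SI0 : SI 0%N = 0 by rewrite /SI big_nil.
have SJ0 : SJ 0%N = 0 by rewrite /SJ big_nil.
rewrite sumU in SFe; last first.
  move=> i j ijn; rewrite !UF; [|by rewrite addSn|by rewrite addnS].
  by rewrite /F SIS SJS; ring.
have Un : U n 0%N = t * n%:R - SI n by rewrite UF ?addn0// /F SJ0 subr0.
have U0 : U 0%N 0%N = last_passage W F n 0 0 by rewrite /U !subn0.
have lip : `|last_passage W (fun i j => dot h (bulk_site i j)) n 0 0 -
    last_passage W F n 0 0| <= 2 * e.
  apply: (@last_passage_lipschitz R _ _ _ _ n) => // i j ijn.
  have i_n : (i <= n)%N by rewrite -ijn leq_addr.
  have j_n : (j <= n)%N by rewrite -ijn leq_addl.
  (* On [i + j = n] the linear terminal value is [t n - A i - B j]. *)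
  have -> : dot h (bulk_site i j) - F i j =
      (SI i - A * i%:R) + (SJ j - B * j%:R).
    by rewrite /dot /F /= h1 h2 -ijn natrD; ring.
  rewrite (le_trans (ler_normD _ _))// mulr_natl mulr2n lerD// ?SIe ?SJe//.
rewrite point_to_line_last_passage -/W.
have := SIe n (leqnn n); move: SFe lip; rewrite U0 Un.
rewrite !ler_norml => /andP[? ?] /andP[? ?] /andP[? ?].
by apply/andP; split; lra.
Qed.

Theorem theorem3p5 (R : realType) (d : measure_display) (T : measurableType d)
    (P : probability T R) (omega : site -> {RV P >-> R})
    (omega_indep : mutually_independent omega)
    (omega_exp : forall x, exponentially_distributed 1 (omega x))
    (h : R * R) :
  {ae P, forall t,
    (fun n : nat => n%:R^-1 * point_to_line (fun x => omega x t) n h)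
      @ \oo --> g_pl h}.
Proof.
set A := g_pl h - h.1; set B := g_pl h - h.2.
have [A0 B0 AB1] : [/\ 0 < A, 0 < B & A^-1 + B^-1 = 1] := stationary_parameters h.
have a0 : 0 < A^-1 by rewrite invr_gt0.
have b0 : 0 < B^-1 by rewrite invr_gt0.
have ab0 : 0 < A^-1 + B^-1 by rewrite AB1.
pose X k t := (stationary_rate A^-1 B^-1 k)^-1 * omega k t.
have iX : indep_laws P X (stationary_law a0 b0 ab0).
  exact: indep_laws_stationary.
have row_uniq n : uniq (map row_site (iota 0 n)).
  rewrite map_inj_uniq ?iota_uniq// => i j /eqP.
by rewrite row_site_eq => /eqP.
have col_uniq n : uniq (map col_site (iota 0 n)).
  rewrite map_inj_uniq ?iota_uniq// => i j /eqP.
  by rewrite col_site_eq => /eqP.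
have row_size n : size (map row_site (iota 0 n)) = n by rewrite size_map size_iota.
have col_size n : size (map col_site (iota 0 n)) = n by rewrite size_map size_iota.
have row_law (n : nat) k : k \in map row_site (iota 0 n) ->
    stationary_law a0 b0 ab0 k = exp_law a0.
  by move=> /mapP[i _ ->]; exact: stationary_law_row.
have col_law (n : nat) k : k \in map col_site (iota 0 n) ->
    stationary_law a0 b0 ab0 k = exp_law b0.
  by move=> /mapP[i _ ->]; exact: stationary_law_col.
have LI := exp_law_of_large_numbers (fun=> iX) row_uniq row_size row_law.
have LJ := exp_law_of_large_numbers (fun=> iX) col_uniq col_size col_law.
(* The array is genuinely triangular here: the flipped field depends on [n]. *)
have LF := exp_law_of_large_numbers (fun n => indep_laws_triangle_flip 0 n iX)
  row_uniq row_size row_law.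
rewrite !invrK in LI LJ LF.
move: LI LJ LF; apply: filterS3 => t LI LJ LF.
apply/cvgrPdist_le => e e0.
have e5 : 0 < e / 4 by rewrite divr_gt0.
near=> n.
have n0 : 0 < n%:R :> R by rewrite ltr0n; near: n; exists 1%N.
have := @point_to_line_stationary R (fun x => omega x t) A B (g_pl h) (X^~ t)
  h n (e / 4 * n%:R).
rewrite !subKr => /(_ erefl erefl) H.
have {}H : `|point_to_line (fun x => omega x t) n h - g_pl h * n%:R| <=
    4 * (e / 4 * n%:R).
  apply: H.
  (* Bulk sites have rate [A^-1 + B^-1 = 1], so the rescaling leaves their weights unchanged. *)
  - move=> i j; rewrite /X /stationary_rate /bulk_site /=.
    by rewrite AB1 invr1 mul1r.
  - by near: n; exact: cesaro_uniform.
  - by near: n; exact: cesaro_uniform.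
  (* [cesaro_uniform] is applied to the diagonal sequence, where the sum up to [i] uses
     [triangle_flip 0 i], and then taken at [i = n]. *)
  - suff : forall i, (i <= n)%N ->
      `|\sum_(k <- map row_site (iota 0 i)) triangle_flip 0 i (X^~ t) k - A * i%:R|
        <= e / 4 * n%:R by apply.
    by near: n; exact: (cesaro_uniform LF e5).
rewrite distrC -(ler_pM2r n0) -[X in `|_| * X](gtr0_norm n0) -normrM mulrBl.
rewrite [_ * point_to_line _ _ _]mulrC divfK ?gt_eqF//.
by apply: le_trans H _; rewrite mulrA [4 * _]mulrC divfK.
Unshelve. all: by end_near. Qed.
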